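(* Let $\vec\omega\in\mathbb R^3$ be a constant nonzero vector, $\vec r_0,\vec v_0\in\mathbb R^3$, and let $\vec f:[0,T)\to\mathbb R^3$ be continuous ($0<T\le\infty$). The solution of the Cauchy problem $$\ddot{\vec r}+2\vec\omega\times\dot{\vec r}+\vec\omega\times(\vec\omega\times\vec r)=\vec f,\qquad \vec r(0)=\vec r_0,\quad \dot{\vec r}(0)=\vec v_0,$$ is $$\vec r=\vec g_0+\vec\omega\times\vec g_1+\vec\omega\times(\vec\omega\times\vec g_2),$$ where, for $k=0,1,2$, $$\vec g_k(t)=\varphi_k(t)\left[\vec r_0+(\vec v_0+\vec\omega\times\vec r_0)t\right]+\big((t\varphi_k)*\vec f\,\big)(t),$$ $$\varphi_0(t)=1,\qquad \varphi_1(t)=-\frac{\sin(\|\vec\omega\|t)}{\|\vec\omega\|},\qquad \varphi_2(t)=\frac{1-\cos(\|\vec\omega\|t)}{\|\vec\omega\|^2}.$$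
   Context: Vectors are in oriented Euclidean three-space, $\times$ is the cross product, the dot denotes $d/dt$. $t\varphi_k$ denotes the function $\tau\mapsto\tau\varphi_k(\tau)$, and $(\varphi*\vec f)(t)=\int_0^t\varphi(\tau)\vec f(t-\tau)\,d\tau$ (componentwise). *)

(* Defs.v *)
From Stdlib Require Import Reals.
From Coquelicot Require Import Coquelicot.
Open Scope R_scope.

(* Oriented Euclidean three-space, in coordinates with respect to a positively
   oriented orthonormal basis.  Coquelicot's norm on a product is
   sqrt (|x|^2 + |y|^2), so [norm] on [E3] is the Euclidean norm
   (see [norm_E3]). *)
Definition E3 : NormedModule R_AbsRing :=
  prod_NormedModule R_AbsRing
    (prod_NormedModule R_AbsRing R_NormedModule R_NormedModule) R_NormedModule.

Definition vec (x y z : R) : E3 := ((x, y), z).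
Definition cx (u : E3) : R := fst (fst u).
Definition cy (u : E3) : R := snd (fst u).
Definition cz (u : E3) : R := snd u.

Lemma norm_E3 (u : E3) : norm u = sqrt (cx u ^ 2 + cy u ^ 2 + cz u ^ 2).
Proof.
destruct u as [[x y] z].
change (sqrt (sqrt (Rabs x ^ 2 + Rabs y ^ 2) ^ 2 + Rabs z ^ 2)
        = sqrt (x ^ 2 + y ^ 2 + z ^ 2)).
rewrite !pow2_abs, pow2_sqrt; [reflexivity|].
apply Rplus_le_le_0_compat; apply pow2_ge_0.
Qed.

Definition cross (u v : E3) : E3 :=
  vec (cy u * cz v - cz u * cy v)
      (cz u * cx v - cx u * cz v)
      (cx u * cy v - cy u * cx v).

(* The interval [0,T), with T possibly infinite. *)
Definition time_interval (T : Rbar) (t : R) : Prop := 0 <= t /\ Rbar_lt t T.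

(* [is_derive] with increments restricted to D; for D = [0,T) this is the
   ordinary derivative at t > 0 and the right derivative at t = 0. *)
Definition is_derive_within (D : R -> Prop) (f : R -> E3) (t : R) (l : E3)
  : Prop :=
  filterdiff f (within D (locally t)) (fun h : R => scal h l).

(* r is twice differentiable on [0,T) (v is its velocity and a its
   acceleration at t) and solves the Cauchy problem there; the values of r and
   f outside [0,T) are irrelevant. *)
Definition solves_cauchy (w : E3) (f : R -> E3) (T : Rbar) (r0 v0 : E3)
    (r : R -> E3) : Prop :=
  exists v : R -> E3,
    (forall t, time_interval T t ->
       is_derive_within (time_interval T) r t (v t) /\
       exists a : E3,
         is_derive_within (time_interval T) v t a /\
         plus (plus a (scal 2 (cross w (v t)))) (cross w (cross w (r t))) = f t)
    /\ r 0 = r0 /\ v 0 = v0.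

Definition phi0 (t : R) : R := 1.
Definition phi1 (w : E3) (t : R) : R := - (sin (norm w * t) / norm w).
Definition phi2 (w : E3) (t : R) : R := (1 - cos (norm w * t)) / norm w ^ 2.

Definition conv (phi : R -> R) (f : R -> E3) (t : R) : E3 :=
  vec (RInt (fun tau => phi tau * cx (f (t - tau))) 0 t)
      (RInt (fun tau => phi tau * cy (f (t - tau))) 0 t)
      (RInt (fun tau => phi tau * cz (f (t - tau))) 0 t).

Definition g (phi : R -> R) (w : E3) (f : R -> E3) (r0 v0 : E3) (t : R) : E3 :=
  plus (scal (phi t) (plus r0 (scal t (plus v0 (cross w r0)))))
       (conv (fun tau => tau * phi tau) f t).

(* Main.v *)
Require Import Defs.
From Stdlib Require Import Reals Lra.
From Coquelicot Require Import Coquelicot.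
Open Scope R_scope.

(** The equation is a square: with D = d/dt + w x, it reads D (D r) = f.
    Hence r is a solution exactly when r and u = r' + w x r satisfy the
    triangular first-order system

      u' = f - w x u,   u(0) = v0 + w x r0,      r' = u - w x r,   r(0) = r0.

    Uniqueness.  A difference d of two solutions of D x = h satisfies
    d' = - w x d, which is orthogonal to d, so the squared length of d is
    constant ([transport_zero]).  Apply this to u, then to r
    ([transport_unique]).

    Existence.  The function I + phi1 (w x) + phi2 (w x)(w x) of the theorem is
    the rotation [rot w t] = exp (- t (w x)): by (w x)^3 = - |w|^2 (w x), it
    satisfies D (rot w t) = 0 ([is_derive_rot]) and the group law ([rot_add]).
    In the rotating frame, that is after u = rot w t A and r = rot w t B, the
    system becomes A' = rot w (- t) f and B' = A, the motion of a free
    particle under a force, so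

      A(t) = u0 + P(t),   B(t) = r0 + t u0 + t P(t) - Q(t),   u0 = u(0),

    where P and Q are the primitives from 0 of rot w (- s) f(s) and of
    s rot w (- s) f(s).  Substituting s = t - tau turns rot w t (t P - Q) into
    the integral of tau rot w tau f(t - tau), which is the combination of the
    three convolutions in the theorem ([closed_form_rot]). *)

(** * Coordinates and linear maps of three-space *)

Lemma E3_ext (u v : E3) : cx u = cx v -> cy u = cy v -> cz u = cz v -> u = v.
Proof.
destruct u as [[x y] z]; destruct v as [[x' y'] z'].
unfold cx, cy, cz; simpl; intros -> -> ->; reflexivity.
Qed.

Ltac coords :=
  apply E3_ext; unfold cross, vec, cx, cy, cz; cbn;
  unfold mult, plus, opp, zero; cbn.

Lemma is_linear_cx : is_linear cx.
Proof. exact (is_linear_comp _ _ is_linear_fst is_linear_fst). Qed.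

Lemma is_linear_cy : is_linear cy.
Proof. exact (is_linear_comp _ _ is_linear_fst is_linear_snd). Qed.

Lemma is_linear_cz : is_linear cz.
Proof. exact is_linear_snd. Qed.

Lemma is_linear_plus_fct {U V : NormedModule R_AbsRing} (l m : U -> V) :
  is_linear l -> is_linear m -> is_linear (fun x => plus (l x) (m x)).
Proof.
intros hl hm.
exact (is_linear_comp _ _ (is_linear_prod _ _ hl hm) is_linear_plus).
Qed.

Lemma is_linear_scal_fct {U V : NormedModule R_AbsRing} (k : R) (l : U -> V) :
  is_linear l -> is_linear (fun x => scal k (l x)).
Proof.
intros hl; exact (is_linear_comp _ _ hl (is_linear_scal_r k Rmult_comm)).
Qed.

Lemma is_linear_cross (w : E3) : is_linear (cross w).
Proof.
assert (hd : forall (a b : R) (l m : E3 -> R_NormedModule),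
  is_linear l -> is_linear m ->
  is_linear (fun u => a * l u - b * m u : R_NormedModule)).
{ intros a b l m hl hm.
  apply is_linear_ext with (fun u => plus (scal a (l u)) (scal (- b) (m u))).
  - intros u. change (a * l u + - b * m u = a * l u - b * m u). ring.
  - apply is_linear_plus_fct; apply is_linear_scal_fct; assumption. }
unfold cross, vec.
apply (is_linear_prod (U := prod_NormedModule _ R_NormedModule R_NormedModule)).
apply (is_linear_prod (U := R_NormedModule)).
- exact (hd _ _ _ _ is_linear_cz is_linear_cy).
- exact (hd _ _ _ _ is_linear_cx is_linear_cz).
- exact (hd _ _ _ _ is_linear_cy is_linear_cx).
Qed.

(** * The rotation group about w *)

(** exp (- t (w x)), written with the functions of the theorem. *)
Definition rot (w : E3) (t : R) (x : E3) : E3 :=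
  plus (plus x (scal (phi1 w t) (cross w x)))
       (scal (phi2 w t) (cross w (cross w x))).

Lemma is_linear_rot (w : E3) (t : R) : is_linear (rot w t).
Proof.
pose proof (is_linear_cross w) as hc.
unfold rot; apply is_linear_plus_fct; [apply is_linear_plus_fct|].
- apply is_linear_id.
- apply is_linear_scal_fct, hc.
- apply is_linear_scal_fct, is_linear_comp; exact hc.
Qed.

Lemma norm_neq_0 (w : E3) : w <> zero -> norm w <> 0.
Proof. intros hw h; apply hw, norm_eq_zero, h. Qed.

(** The only property of the cross product behind the closed form: restricted to
    the plane orthogonal to w, (w x)^2 is multiplication by - |w|^2. *)
Lemma cross3 (w x : E3) :
  cross w (cross w (cross w x)) = scal (- norm w ^ 2) (cross w x).
Proof.
replace (norm w ^ 2) with (cx w ^ 2 + cy w ^ 2 + cz w ^ 2).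
- coords; ring.
- rewrite norm_E3, pow2_sqrt; [reflexivity|].
  assert (H := fun a : R => pow2_ge_0 a).
  apply Rplus_le_le_0_compat; [apply Rplus_le_le_0_compat|]; apply H.
Qed.

Lemma rot_0 (w x : E3) : rot w 0 x = x.
Proof.
unfold rot, phi1, phi2.
rewrite Rmult_0_r, sin_0, cos_0.
unfold Rdiv; rewrite Rmult_0_l, Rminus_diag, Rmult_0_l, Ropp_0.
coords; ring.
Qed.

(** By [cross3], both sides are combinations of x, w x x and w x (w x x), and
    equality of coefficients is the addition formula for sin and cos. *)
Lemma rot_add (w x : E3) (s t : R) :
  w <> zero -> rot w s (rot w t x) = rot w (s + t) x.
Proof.
intros hw; apply norm_neq_0 in hw.
assert (h1 : phi1 w (s + t) = phi1 w s + phi1 w t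
   - norm w ^ 2 * (phi1 w s * phi2 w t + phi2 w s * phi1 w t)).
{ unfold phi1, phi2; rewrite Rmult_plus_distr_l, sin_plus; field; exact hw. }
assert (h2 : phi2 w (s + t) = phi2 w s + phi2 w t + phi1 w s * phi1 w t
   - norm w ^ 2 * (phi2 w s * phi2 w t)).
{ unfold phi1, phi2; rewrite Rmult_plus_distr_l, cos_plus; field; exact hw. }
unfold rot at 1 3; rewrite h1, h2; clear h1 h2.
unfold rot.
generalize (phi1 w s) (phi1 w t) (phi2 w s) (phi2 w t); intros a b c d.
pose proof (is_linear_cross w) as hc.
repeat rewrite ?(linear_plus _ hc), ?(linear_scal _ hc), ?cross3.
generalize (cross w (cross w x)) (cross w x); intros y z.
coords; ring.
Qed.

(** * Calculus of curves in three-space *)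

Lemma is_derive_linear {U V : NormedModule R_AbsRing} (l : U -> V)
    (x : R -> U) (t : R) (dx : U) :
  is_linear l -> is_derive x t dx -> is_derive (fun s => l (x s)) t (l dx).
Proof.
intros hl hx; unfold is_derive.
apply filterdiff_ext_lin with (fun h : R => l (scal h dx)).
- apply (filterdiff_comp' x l t (fun h : R => scal h dx) l hx).
  apply filterdiff_linear, hl.
- intros h; apply (linear_scal _ hl).
Qed.

Lemma is_derive_scal_fct (k : R -> R) (x : R -> E3) (t dk : R) (dx : E3) :
  is_derive k t dk -> is_derive x t dx ->
  is_derive (fun s => scal (k s) (x s)) t
    (plus (scal dk (x t)) (scal (k t) dx)).
Proof.
intros hk hx; unfold is_derive.
eapply filterdiff_ext_lin.
- apply (filterdiff_scal_fct (K := R_AbsRing) t k x _ _ Rmult_comm hk hx).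
- intros h; coords; ring.
Qed.

(** [rot w s] satisfies X' = - w x X, so applying it to a curve turns d/dt into
    d/dt + w x. *)
Lemma is_derive_rot (w : E3) (x : R -> E3) (t : R) (dx : E3) :
  w <> zero -> is_derive x t dx ->
  is_derive (fun s => rot w s (x s)) t
    (minus (rot w t dx) (cross w (rot w t (x t)))).
Proof.
intros hw hx; apply norm_neq_0 in hw.
assert (h1 : is_derive (phi1 w) t (norm w ^ 2 * phi2 w t - 1)).
{ unfold phi1, phi2; auto_derive; [exact I | field; exact hw]. }
assert (h2 : is_derive (phi2 w) t (- phi1 w t)).
{ unfold phi1, phi2; auto_derive; [exact I | field; exact hw]. }
pose proof (is_linear_cross w) as hc.
pose proof (is_derive_linear _ _ _ _ hc hx) as hx1.
pose proof (is_derive_linear _ _ _ _ hc hx1) as hx2.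
unfold rot.
evar_last.
- apply (is_derive_plus (K := R_AbsRing));
    [apply (is_derive_plus (K := R_AbsRing)); [exact hx|]|];
    apply is_derive_scal_fct; eassumption.
- cbv beta; repeat rewrite ?(linear_plus _ hc), ?(linear_scal _ hc), ?cross3.
  generalize (cross w (cross w (x t))) (cross w (x t)).
  generalize (cross w (cross w dx)) (cross w dx); intros a b c d.
  coords; ring.
Qed.

Lemma Riemann_sum_linear {U V : NormedModule R_AbsRing} (l : U -> V)
    (x : R -> U) (ptd : SF_seq) :
  is_linear l -> Riemann_sum (fun s => l (x s)) ptd = l (Riemann_sum x ptd).
Proof.
intros hl; revert ptd; apply SF_cons_ind.
- intros x0; symmetry; apply (linear_zero _ hl).
- intros [a b] s IH.
  rewrite !Riemann_sum_cons, IH, (linear_plus _ hl), (linear_scal _ hl).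
  reflexivity.
Qed.

(** Linear maps commute with Riemann sums and are continuous, hence pass to the
    limit of those sums. *)
Lemma is_RInt_linear {U V : NormedModule R_AbsRing} (l : U -> V)
    (x : R -> U) (a b : R) (I : U) :
  is_linear l -> is_RInt x a b I -> is_RInt (fun s => l (x s)) a b (l I).
Proof.
intros hl hx; unfold is_RInt.
apply filterlim_ext
  with (fun ptd => l (scal (sign (b - a)) (Riemann_sum x ptd))).
- intros ptd; rewrite (Riemann_sum_linear _ _ _ hl); apply (linear_scal _ hl).
- apply filterlim_comp with (2 := linear_cont l I hl); exact hx.
Qed.

Lemma is_RInt_E3_unique (x : R -> E3) (a b : R) (I J : E3) :
  is_RInt x a b I -> is_RInt x a b J -> I = J.
Proof.
apply (filterlim_locally_unique (F := Riemann_fine a b)).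
Qed.

(** A coordinatewise total integral: three-space is only a normed module here,
    while [RInt] asks for a complete one. *)
Definition RInt3 (x : R -> E3) (a b : R) : E3 :=
  vec (RInt (fun s => cx (x s)) a b)
      (RInt (fun s => cy (x s)) a b)
      (RInt (fun s => cz (x s)) a b).

Lemma RInt3_correct (x : R -> E3) (a b : R) :
  (forall s, Rmin a b <= s <= Rmax a b -> continuous x s) ->
  is_RInt x a b (RInt3 x a b).
Proof.
intros hx.
assert (h : forall l : E3 -> R, is_linear (V := R_NormedModule) l ->
  is_RInt (fun s => l (x s)) a b (RInt (fun s => l (x s)) a b)).
{ intros l hl; apply (RInt_correct (V := R_CompleteNormedModule)).
  apply ex_RInt_continuous; intros s hs.
  apply (continuous_comp x l); [apply hx, hs | apply (linear_cont _ _ hl)]. }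
unfold RInt3, vec.
apply (is_RInt_fct_extend_pair
  (U := prod_NormedModule _ R_NormedModule R_NormedModule)
  (V := R_NormedModule)).
1: apply (is_RInt_fct_extend_pair (U := R_NormedModule) (V := R_NormedModule)).
- exact (h _ is_linear_cx).
- exact (h _ is_linear_cy).
- exact (h _ is_linear_cz).
Qed.

Lemma RInt3_primitive (x : R -> E3) (T : Rbar) :
  Rbar_lt 0 T -> (forall s : R, Rbar_lt s T -> continuous x s) ->
  RInt3 x 0 0 = zero /\
  forall t : R, Rbar_lt t T ->
    is_RInt x 0 t (RInt3 x 0 t) /\ is_derive (RInt3 x 0) t (x t).
Proof.
intros hT hx.
assert (hI : forall t : R, Rbar_lt t T -> is_RInt x 0 t (RInt3 x 0 t)).
{ intros t ht; apply RInt3_correct; intros s hs; apply hx.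
  apply Rbar_le_lt_trans with (Rmax 0 t); [apply hs|].
  unfold Rmax; destruct (Rle_dec 0 t); assumption. }
split.
- apply (is_RInt_E3_unique x 0 0); [apply hI, hT | apply is_RInt_point].
- intros t ht; split; [exact (hI t ht)|].
  apply is_derive_RInt with 0; [|exact (hx t ht)].
  apply (filter_imp _ _ hI); exact (open_Rbar_lt' (Finite t) T ht).
Qed.

(** * Derivatives relative to a half-open interval *)

Lemma is_filter_lim_within (D : R -> Prop) (t s : R) :
  D t -> is_filter_lim (within D (locally t)) s -> s = t.
Proof.
intros ht hs.
assert (hF : ProperFilter' (within D (locally t))).
{ constructor; [|apply within_filter, locally_filter].
  intros h; exact (locally_singleton _ _ h ht). }
apply (is_filter_lim_unique (K := R_AbsRing) (V := R_NormedModule)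
         (F := within D (locally t))).
- exact hs.
- intros P hP; apply (filter_imp _ _ (fun u hu _ => hu) hP).
Qed.

Lemma is_derive_within_of_derive (D : R -> Prop) (x : R -> E3) (t : R)
    (dx : E3) :
  D t -> is_derive x t dx -> is_derive_within D x t dx.
Proof.
intros ht [hl hd]; split; [exact hl|].
intros s hs eps; rewrite (is_filter_lim_within _ _ _ ht hs).
refine (filter_imp _ _ (fun u hu _ => hu) _).
apply hd; intros P hP; exact hP.
Qed.

Lemma is_derive_of_derive_within (D : R -> Prop) (x : R -> E3) (t : R)
    (dx : E3) :
  locally t D -> is_derive_within D x t dx -> is_derive x t dx.
Proof.
intros hD [hl hd]; split; [exact hl|].
intros s hs eps.
assert (hs' : is_filter_lim (within D (locally t)) s).
{ intros P hP; exact (filter_imp _ _ (fun u hu _ => hu) (hs P hP)). }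
refine (filter_imp _ _ _ (filter_and _ _ hD (hd s hs' eps))).
intros u [hu h]; exact (h hu).
Qed.

Lemma is_derive_within_ext (D : R -> Prop) (x y : R -> E3) (t : R) (dx : E3) :
  D t -> (forall s, D s -> x s = y s) ->
  is_derive_within D x t dx -> is_derive_within D y t dx.
Proof.
intros ht hxy [hl hd]; split; [exact hl|].
intros s hs eps; generalize (hd s hs eps).
rewrite (is_filter_lim_within _ _ _ ht hs), (hxy t ht).
unfold within; apply filter_imp; intros u h hu.
rewrite <- (hxy u hu); exact (h hu).
Qed.

Lemma locally_time_interval (T : Rbar) (t : R) :
  0 < t -> Rbar_lt t T -> locally t (time_interval T).
Proof.
intros h0 hT.
refine (filter_imp _ _ _
  (filter_and _ _ (open_gt 0 t h0) (open_Rbar_lt' (Finite t) T hT))).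
intros s [hs0 hsT]; split; [left; exact hs0 | exact hsT].
Qed.

(** Freezing x at its value at 0 on the negative axis makes it continuous on a
    neighbourhood of [0,T), where two-sided derivatives and the usual mean value
    theorem apply. *)
Lemma continuous_clamp {U : UniformSpace} (T : Rbar) (x : R -> U) (t : R) :
  Rbar_lt 0 T -> continuous_on (time_interval T) x -> Rbar_lt t T ->
  continuous (fun s => x (Rmax 0 s)) t.
Proof.
intros hT hx ht.
apply filterlim_comp
  with (within (time_interval T) (locally (Rmax 0 t))).
- intros P [eps hP].
  assert (hball : locally t (fun s => ball (Rmax 0 t) eps (Rmax 0 s))).
  { exists eps; intros s hs.
    change (Rabs (Rmax 0 s - Rmax 0 t) < eps).
    change (Rabs (s - t) < eps) in hs.
    apply Rle_lt_trans with (2 := hs).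
    unfold Rmax; destruct (Rle_dec 0 s), (Rle_dec 0 t);
      unfold Rabs; repeat destruct Rcase_abs; lra. }
  refine (filter_imp _ _ _
    (filter_and _ _ hball (open_Rbar_lt' (Finite t) T ht))).
  intros s [hs hsT]; apply (hP _ hs); split; [apply Rmax_l|].
  unfold Rmax; destruct (Rle_dec 0 s); assumption.
- apply hx; split; [apply Rmax_l|].
  unfold Rmax; destruct (Rle_dec 0 t); assumption.
Qed.

Lemma continuous_on_of_derive_within (D : R -> Prop) (x dx : R -> E3) :
  (forall t, D t -> is_derive_within D x t (dx t)) -> continuous_on D x.
Proof.
intros hx t ht.
assert (hF : Filter (within D (locally t))).
{ apply within_filter, locally_filter. }
apply (filterdiff_continuous_aux (K := R_AbsRing) x).
- eexists; exact (hx t ht).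
- intros P hP; exact (filter_imp _ _ (fun u hu _ => hu) hP).
Qed.

(** * Uniqueness for x' + w x x = h *)

(** The derivative of |d|^2 is - 2 d . (w x d) = 0, so |d|^2 keeps its value 0. *)
Lemma transport_zero (w : E3) (T : Rbar) (d : R -> E3) :
  Rbar_lt 0 T ->
  (forall t, time_interval T t ->
    is_derive_within (time_interval T) d t (opp (cross w (d t)))) ->
  d 0 = zero -> forall t, time_interval T t -> d t = zero.
Proof.
intros hT hd h0 t [ht0 htT].
set (N := fun u : E3 => cx u ^ 2 + cy u ^ 2 + cz u ^ 2).
assert (hc : forall s : R, Rbar_lt s T ->
  continuous (fun s => d (Rmax 0 s)) s).
{ intros s hs; apply (continuous_clamp T); try assumption.
  exact (continuous_on_of_derive_within _ _ _ hd). }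
assert (hlt : forall s : R, s <= t -> Rbar_lt s T).
{ intros s hs; exact (Rbar_le_lt_trans (Finite s) (Finite t) T hs htT). }
destruct (MVT_gen (fun s => N (d (Rmax 0 s))) 0 t (fun _ => 0))
  as [c [_ hN]].
- rewrite (Rmin_left 0 t ht0), (Rmax_right 0 t ht0); intros s [hs0 hst].
  pose proof (hlt s (Rlt_le _ _ hst)) as hsT.
  apply (is_derive_ext_loc (fun s => N (d s))).
  { apply (filter_imp (fun u => 0 < u)); [|exact (open_gt 0 s hs0)].
    intros u hu; rewrite Rmax_right; [reflexivity | left; exact hu]. }
  pose proof (is_derive_of_derive_within _ _ _ _
    (locally_time_interval T s hs0 hsT) (hd s (conj (Rlt_le _ _ hs0) hsT)))
    as hds.
  pose proof (is_derive_linear _ _ _ _ is_linear_cx hds) as hdx.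
  pose proof (is_derive_linear _ _ _ _ is_linear_cy hds) as hdy.
  pose proof (is_derive_linear _ _ _ _ is_linear_cz hds) as hdz.
  unfold N; evar_last.
  + apply (is_derive_plus (V := R_NormedModule));
      [apply (is_derive_plus (V := R_NormedModule))|];
      apply is_derive_pow; eassumption.
  + cbv beta; generalize (d s); intros a; unfold cross, vec, cx, cy, cz; cbn.
    unfold plus, opp; cbn; ring.
- rewrite (Rmin_left 0 t ht0), (Rmax_right 0 t ht0); intros s [hs0 hst].
  apply continuity_pt_filterlim.
  pose proof (hc s (hlt s hst)) as hs.
  assert (hl : forall l : E3 -> R, is_linear (V := R_NormedModule) l ->
    continuous (fun s => l (d (Rmax 0 s)) ^ 2) s).
  { intros l hl.
    apply (continuous_comp (fun s => l (d (Rmax 0 s))) (fun u => u ^ 2)).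
    - apply (continuous_comp (fun s => d (Rmax 0 s)) l); [exact hs|].
      apply (linear_cont _ _ hl).
    - apply (ex_derive_continuous (fun u => u ^ 2)); auto_derive; exact I. }
  apply (continuous_plus (V := R_NormedModule));
    [apply (continuous_plus (V := R_NormedModule))|].
  + exact (hl _ is_linear_cx).
  + exact (hl _ is_linear_cy).
  + exact (hl _ is_linear_cz).
- rewrite (Rmax_right 0 t ht0), (Rmax_left 0 0 (Rle_refl 0)), h0 in hN.
  assert (h00 : N zero = 0).
  { unfold N, cx, cy, cz; cbn; unfold zero; cbn; ring. }
  apply norm_eq_zero; rewrite norm_E3.
  change (sqrt (N (d t)) = 0).
  replace (N (d t)) with 0 by lra; apply sqrt_0.
Qed.

Lemma transport_unique (w : E3) (T : Rbar) (h x y : R -> E3) :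
  Rbar_lt 0 T ->
  (forall t, time_interval T t ->
    is_derive_within (time_interval T) x t (minus (h t) (cross w (x t)))) ->
  (forall t, time_interval T t ->
    is_derive_within (time_interval T) y t (minus (h t) (cross w (y t)))) ->
  x 0 = y 0 -> forall t, time_interval T t -> x t = y t.
Proof.
intros hT hx hy h0 t ht.
assert (hd : minus (x t) (y t) = zero).
{ apply (transport_zero w T (fun s => minus (x s) (y s))); try assumption.
  - intros s hs.
    assert (hF : Filter (within (time_interval T) (locally s))).
    { apply within_filter, locally_filter. }
    refine (filterdiff_ext_lin _ _ _
      (filterdiff_minus_fct _ _ _ _ (hx s hs) (hy s hs)) _).
    intros k; generalize (x s) (y s) (h s); intros a b c; coords; ring.
  - rewrite h0; apply (minus_eq_zero (y 0)). }
replace (x t) with (plus (y t) (minus (x t) (y t))) by (coords; ring).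
rewrite hd; coords; ring.
Qed.

(** * The closed form as a solution *)

Lemma is_RInt_reflect {V : NormedModule R_AbsRing} (x : R -> V) (t : R)
    (J : V) :
  is_RInt x 0 t J -> is_RInt (fun s => x (t - s)) 0 t J.
Proof.
intros h; apply is_RInt_swap in h.
assert (h' : is_RInt x (- 1 * 0 + t) (- 1 * t + t) (opp J)).
{ replace (- 1 * 0 + t) with t by ring.
  replace (- 1 * t + t) with 0 by ring; exact h. }
apply is_RInt_comp_lin, is_RInt_opp in h'; rewrite opp_opp in h'.
apply is_RInt_ext with (2 := h'); intros s _.
replace (- 1 * s + t) with (t - s) by ring.
rewrite (scal_opp_one (K := R_AbsRing) (x (t - s)) : scal (- 1) _ = _).
exact (opp_opp (x (t - s))).
Qed.

Lemma conv_correct (T : Rbar) (f : R -> E3) (phi : R -> R) (t : R) :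
  Rbar_lt 0 T -> continuous_on (time_interval T) f ->
  (forall s, continuous phi s) -> time_interval T t ->
  is_RInt (fun s => scal (phi s) (f (t - s))) 0 t (conv phi f t).
Proof.
intros hT hf hphi [ht0 htT].
assert (heq : forall s, Rmin 0 t < s < Rmax 0 t -> Rmax 0 (t - s) = t - s).
{ rewrite (Rmin_left 0 t ht0), (Rmax_right 0 t ht0); intros s hs.
  apply Rmax_right; lra. }
set (F := fun s => scal (phi s) (f (Rmax 0 (t - s))) : E3).
apply is_RInt_ext with F.
{ intros s hs; unfold F; rewrite (heq s hs); reflexivity. }
replace (conv phi f t) with (RInt3 F 0 t).
- apply RInt3_correct; intros s.
  rewrite (Rmin_left 0 t ht0), (Rmax_right 0 t ht0); intros hs.
  apply (continuous_scal (K := R_AbsRing) phi); [apply hphi|].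
  apply (continuous_comp (fun s => t - s) (fun s => f (Rmax 0 s))).
  + apply (ex_derive_continuous (fun s => t - s)); auto_derive; exact I.
  + apply (continuous_clamp T); try assumption.
    apply (Rbar_le_lt_trans (Finite (t - s)) (Finite t) T); [|exact htT].
    simpl; lra.
- unfold RInt3, conv; f_equal; apply RInt_ext; intros s hs;
    unfold F; rewrite (heq s hs); reflexivity.
Qed.

(** The right-hand side of the theorem. *)
Definition closed_form (w r0 v0 : E3) (f : R -> E3) (t : R) : E3 :=
  plus (plus (g phi0 w f r0 v0 t) (cross w (g (phi1 w) w f r0 v0 t)))
       (cross w (cross w (g (phi2 w) w f r0 v0 t))).

(** The initial data and the convolutions enter [closed_form] through the same
    operator I + phi1 (w x) + phi2 (w x)(w x), which moves under the integral by
    linearity. *)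
Lemma closed_form_rot (w r0 v0 : E3) (T : Rbar) (f : R -> E3) (t : R) (I : E3) :
  w <> zero -> Rbar_lt 0 T -> continuous_on (time_interval T) f ->
  time_interval T t ->
  is_RInt (fun s => scal s (rot w s (f (t - s)))) 0 t I ->
  closed_form w r0 v0 f t =
  plus (rot w t (plus r0 (scal t (plus v0 (cross w r0))))) I.
Proof.
intros hw hT hf ht hI; apply norm_neq_0 in hw.
pose proof (is_linear_cross w) as hc.
assert (hphi : forall phi : R -> R, (forall s, ex_derive phi s) ->
  is_RInt (fun s => scal (s * phi s) (f (t - s))) 0 t
    (conv (fun s => s * phi s) f t)).
{ intros phi hphi; apply (conv_correct T); try assumption.
  intros s; apply (ex_derive_continuous (fun s => s * phi s)).
  apply (ex_derive_mult (fun s => s)); [apply ex_derive_id | apply hphi]. }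
set (J0 := conv (fun s => s * phi0 s) f t).
set (J1 := conv (fun s => s * phi1 w s) f t).
set (J2 := conv (fun s => s * phi2 w s) f t).
assert (hJ : I = plus (plus J0 (cross w J1)) (cross w (cross w J2))).
{ apply (is_RInt_E3_unique (fun s => scal s (rot w s (f (t - s)))) 0 t);
    [exact hI|].
  assert (h0 := hphi phi0 (fun s => ex_derive_const 1 s)).
  assert (h1 := hphi (phi1 w)
    ltac:(intros s; unfold phi1; auto_derive; exact Logic.I)).
  assert (h2 := hphi (phi2 w)
    ltac:(intros s; unfold phi2; auto_derive; exact Logic.I)).
  apply (is_RInt_linear _ _ _ _ _ hc) in h1.
  apply (is_RInt_linear _ _ _ _ _ hc) in h2.
  apply (is_RInt_linear _ _ _ _ _ hc) in h2.
  apply is_RInt_ext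
    with (2 := is_RInt_plus _ _ _ _ _ _ (is_RInt_plus _ _ _ _ _ _ h0 h1) h2).
  intros s _; unfold rot, phi0.
    rewrite ?(linear_scal _ hc).
    generalize (f (t - s)); intros y.
    generalize (cross w (cross w y)) (cross w y); intros a b.
    coords; ring. }
rewrite hJ; unfold closed_form, g; fold J0 J1 J2; unfold rot, phi0.
rewrite ?(linear_plus _ hc), ?(linear_scal _ hc).
generalize (cross w (cross w J2)) (cross w J1); intros a b.
coords; ring.
Qed.

(** The function u is r' + w x r for r the closed form.  Differentiation takes
    place in the rotating frame, where the kernel of the integrals no longer
    depends on t. *)
Lemma closed_form_solves (w r0 v0 : E3) (T : Rbar) (f : R -> E3) :
  w <> zero -> Rbar_lt 0 T -> continuous_on (time_interval T) f ->
  exists u : R -> E3,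
    u 0 = plus v0 (cross w r0) /\ closed_form w r0 v0 f 0 = r0 /\
    forall t, time_interval T t ->
      is_derive_within (time_interval T) u t (minus (f t) (cross w (u t))) /\
      is_derive_within (time_interval T) (closed_form w r0 v0 f) t
        (minus (u t) (cross w (closed_form w r0 v0 f t))).
Proof.
intros hw hT hf.
set (u0 := plus v0 (cross w r0)).
set (F := fun s => f (Rmax 0 s)).
set (p := fun s => rot w (- s) (F s)).
set (q := fun s => scal s (p s) : E3).
assert (hF : forall s : R, Rbar_lt s T -> continuous F s).
{ intros s hs; exact (continuous_clamp T f s hT hf hs). }
assert (hp : forall s : R, Rbar_lt s T -> continuous p s).
{ intros s hs; specialize (hF s hs); unfold p, rot.
  assert (hl : forall (phi : R -> R) (l : E3 -> E3),
    (forall s, ex_derive phi s) -> is_linear l ->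
    continuous (fun s => scal (phi (- s)) (l (F s))) s).
  { intros phi l hphi hl; apply (continuous_scal (K := R_AbsRing)).
    - apply (ex_derive_continuous (fun s => phi (- s))).
      apply (ex_derive_comp phi Ropp); [apply hphi|].
      auto_derive; exact I.
    - apply (continuous_comp F l); [exact hF | apply (linear_cont _ _ hl)]. }
  apply (continuous_plus (V := E3)); [apply (continuous_plus (V := E3))|].
  - exact hF.
  - apply (hl (phi1 w) (cross w)); [|apply is_linear_cross].
    intros r; unfold phi1; auto_derive; exact I.
  - apply (hl (phi2 w) (fun x => cross w (cross w x))).
    + intros r; unfold phi2; auto_derive; exact I.
    + apply (is_linear_comp (cross w) (cross w)); apply is_linear_cross. }
assert (hq : forall s : R, Rbar_lt s T -> continuous q s).
{ intros s hs; apply (continuous_scal (K := R_AbsRing) (fun s => s));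
    [apply continuous_id | exact (hp s hs)]. }
destruct (RInt3_primitive p T hT hp) as [hP0 hP].
destruct (RInt3_primitive q T hT hq) as [hQ0 hQ].
set (P := RInt3 p 0) in *; set (Q := RInt3 q 0) in *.
(* Velocity and position in the rotating frame. *)
set (A := fun t => plus u0 (P t)).
set (B := fun t => plus (plus r0 (scal t u0)) (minus (scal t (P t)) (Q t)) : E3).
assert (hform : forall t, time_interval T t ->
  rot w t (B t) = closed_form w r0 v0 f t).
{ intros t [ht0 htT]; symmetry.
  rewrite (closed_form_rot w r0 v0 T f t
    (rot w t (minus (scal t (P t)) (Q t))) hw hT hf (conj ht0 htT)).
  { unfold B; symmetry; apply (linear_plus _ (is_linear_rot w t)). }
  destruct (hP t htT) as [hPt _]; destruct (hQ t htT) as [hQt _].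
  pose proof (is_RInt_linear (rot w t) _ _ _ _ (is_linear_rot w t)
    (is_RInt_minus _ _ _ _ _ _ (is_RInt_scal _ _ _ t _ hPt) hQt)) as h.
  (* Under s = t - tau, the integrand of rot w t (t P - Q) becomes
     rot w t (tau rot w (tau - t) f(t - tau)), and the rotations compose. *)
  apply is_RInt_reflect in h.
  apply is_RInt_ext with (2 := h).
  rewrite (Rmin_left 0 t ht0), (Rmax_right 0 t ht0); intros s hs.
  unfold q, p, F.
  rewrite (Rmax_right 0 (t - s)) by lra.
  replace (rot w s (f (t - s)))
    with (rot w t (rot w (- (t - s)) (f (t - s)))).
  2: { rewrite rot_add by exact hw; f_equal; ring. }
  generalize (rot w (- (t - s)) (f (t - s))); intros y.
  pose proof (is_linear_rot w t) as hl.
  rewrite (linear_minus _ _ _ hl), !(linear_scal _ hl).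
  generalize (rot w t y); intros z; coords; ring. }
assert (h0 : time_interval T 0) by (split; [apply Rle_refl | exact hT]).
exists (fun t => rot w t (A t)).
split; [|split].
- rewrite rot_0; unfold A; rewrite hP0; coords; ring.
- rewrite <- (hform 0 h0), rot_0; unfold B; rewrite hP0, hQ0; coords; ring.
- intros t ht; destruct (hP t (proj2 ht)) as [_ hPt].
  destruct (hQ t (proj2 ht)) as [_ hQt].
  split.
  + apply is_derive_within_of_derive; [exact ht|].
    assert (hA : is_derive A t (p t)).
    { unfold A; evar_last.
      - apply (is_derive_plus (K := R_AbsRing));
          [apply (is_derive_const (K := R_AbsRing) u0) | exact hPt].
      - apply plus_zero_l. }
    evar_last; [exact (is_derive_rot w A t _ hw hA)|].
    f_equal; unfold p; rewrite rot_add by exact hw.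
    rewrite Rplus_opp_r, rot_0; unfold F.
    rewrite Rmax_right by apply ht; reflexivity.
  + rewrite <- (hform t ht).
    apply is_derive_within_ext with (2 := hform); [exact ht|].
    apply is_derive_within_of_derive; [exact ht|].
    apply is_derive_rot; [exact hw|].
    unfold A, B; evar_last.
    * apply (is_derive_plus (K := R_AbsRing));
        [apply (is_derive_plus (K := R_AbsRing))
        |apply (is_derive_minus (K := R_AbsRing))].
      -- apply (is_derive_const (K := R_AbsRing) r0).
      -- apply (is_derive_scal_l (K := R_AbsRing) (fun s : R => s)).
         apply (is_derive_id (K := R_AbsRing)).
      -- apply is_derive_scal_fct; [apply (is_derive_id (K := R_AbsRing))|].
         exact hPt.
      -- exact hQt.
    (* The terms t p(t) from t P and from Q cancel, leaving A. *)
    * cbv beta; unfold q; generalize (p t) (P t); intros a b.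
      unfold one; coords; ring.
Qed.

Theorem mainTheorem13 (w r0 v0 : E3) (T : Rbar) (f : R -> E3)
  (hw : w <> zero) (hT : Rbar_lt 0 T)
  (hf : continuous_on (time_interval T) f) (r : R -> E3) :
  solves_cauchy w f T r0 v0 r <->
  (forall t : R, time_interval T t ->
     r t = plus (plus (g phi0 w f r0 v0 t)
                      (cross w (g (phi1 w) w f r0 v0 t)))
                (cross w (cross w (g (phi2 w) w f r0 v0 t)))).
Proof.
pose proof (is_linear_cross w) as hc.
destruct (closed_form_solves w r0 v0 T f hw hT hf) as [u [hu0 [hr0 hsol]]].
assert (h0 : time_interval T 0) by (split; [apply Rle_refl | exact hT]).
assert (hFilter : forall t, Filter (within (time_interval T) (locally t))).
{ intros t; apply within_filter, locally_filter. }
change (solves_cauchy w f T r0 v0 r <->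
  forall t, time_interval T t -> r t = closed_form w r0 v0 f t).
split.
- intros [v [hv [hri hvi]]].
  set (u' := fun t => plus (v t) (cross w (r t))).
  assert (hu : forall t, time_interval T t -> u' t = u t).
  { apply (transport_unique w T f u' u hT);
      [| intros t ht; exact (proj1 (hsol t ht)) |].
    - intros t ht; destruct (hv t ht) as [hrt [a [hvt heq]]].
      rewrite <- heq; unfold u'.
      refine (filterdiff_ext_lin _ _ _ (filterdiff_plus_fct _ _ _ _ hvt
        (filterdiff_comp r (cross w) _ _ hrt
          (filterdiff_linear (cross w) hc))) _).
      intros k; rewrite (linear_scal _ hc), (linear_plus _ hc).
      generalize (cross w (v t)) (cross w (cross w (r t))); intros b c.
      coords; ring.
    - unfold u'; rewrite hri, hvi, hu0; reflexivity. }
  apply (transport_unique w T u r (closed_form w r0 v0 f) hT);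
    [| intros t ht; exact (proj2 (hsol t ht)) |].
  + intros t ht; rewrite <- (hu t ht); unfold u'.
    replace (minus (plus (v t) (cross w (r t))) (cross w (r t))) with (v t)
      by (generalize (cross w (r t)); intros b; coords; ring).
    exact (proj1 (hv t ht)).
  + rewrite hri, hr0; reflexivity.
- intros hr.
  exists (fun t => minus (u t) (cross w (closed_form w r0 v0 f t))).
  split; [|split].
  + intros t ht; destruct (hsol t ht) as [hut hrt]; split.
    * apply is_derive_within_ext with (closed_form w r0 v0 f);
        [exact ht | | exact hrt].
      intros s hs; symmetry; exact (hr s hs).
    * exists (minus (minus (f t) (cross w (u t))) (cross w
        (minus (u t) (cross w (closed_form w r0 v0 f t))))); split.
      -- refine (filterdiff_ext_lin _ _ _ (filterdiff_minus_fct _ _ _ _ hut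
           (filterdiff_comp _ (cross w) _ _ hrt
             (filterdiff_linear (cross w) hc))) _).
         intros k; rewrite (linear_scal _ hc).
         generalize (cross w (minus (u t) (cross w (closed_form w r0 v0 f t)))).
         generalize (cross w (u t)); intros b c.
         coords; ring.
      -- rewrite (hr t ht), !(linear_minus _ _ _ hc).
         generalize (cross w (cross w (closed_form w r0 v0 f t))) (cross w (u t)).
         intros b c; coords; ring.
  + rewrite (hr 0 h0); exact hr0.
  + rewrite hu0, hr0; coords; ring.
Qed.
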